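(* Consider the planar quadratic system with real coefficients $$\dot x=a_1x+a_2y+a_3x^2+a_4y^2+a_5xy,\qquad \dot y=b_1x+b_2y+b_3x^2+b_4y^2+b_5xy.$$ The parabola $y=mx^2$ is invariant under the flow of the system if and only if both of the following hold: (1) $b_1=0$, $b_4=2a_5$, $a_4=0$; and (2) one of the following conditions holds (with $m$ as indicated): (a) $b_3=0$, $b_2=2a_1$, $b_5\ne 2a_3$ and $a_2\ne 0$ (in this case $m=\frac{b_5-2a_3}{2a_2}$); (b) $b_5=2a_3$, $a_2=0$, $b_3\ne 0$ and $b_2\ne 2a_1$ (in this case $m=\frac{-b_3}{b_2-2a_1}$); (c) $b_3\ne 0$, $b_2\ne 2a_1$, $b_5\ne 2a_3$, $a_2\ne 0$ and $2a_2b_3+b_2b_5-2b_2a_3-2a_1b_5+4a_1a_3=0$ (in this case $m=\frac{-b_3}{b_2-2a_1}=\frac{b_5-2a_3}{2a_2}$); (d) $b_3=0$, $b_2=2a_1$, $b_5=2a_3$ and $a_2=0$ (in this case $m$ is any real number).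
   Context: A set $S\subseteq\mathbb{R}^2$ is invariant under the flow $\Phi_t$ of a planar system if $\Phi_t(X_0)\in S$ for every $X_0\in S$ and every $t$ in the maximal interval of existence $I(X_0)$ of the solution with initial value $X_0$. For $y=mx^2$ to be a parabola one needs $m\neq 0$. *)

(* Defs.v *)
From Stdlib Require Import Reals ClassicalEpsilon.
From Coquelicot Require Import Coquelicot.
Open Scope R_scope.

Definition vector_field := R * R -> R * R.

Definition quadratic_field (a1 a2 a3 a4 a5 b1 b2 b3 b4 b5 : R) : vector_field :=
  fun X => let (x, y) := X in
    (a1 * x + a2 * y + a3 * x ^ 2 + a4 * y ^ 2 + a5 * x * y,
     b1 * x + b2 * y + b3 * x ^ 2 + b4 * y ^ 2 + b5 * x * y).

(* Values of [phi] outside the open interval ]l, r[ are irrelevant. *)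
Definition is_solution_on (F : vector_field) (X0 : R * R) (l r : R)
    (phi : R -> R * R) : Prop :=
  l < 0 < r /\ phi 0 = X0 /\
  forall t, l < t < r ->
    is_derive (fun s => fst (phi s)) t (fst (F (phi t))) /\
    is_derive (fun s => snd (phi s)) t (snd (F (phi t))).

(* [X] is the value at time [t] of some solution starting from [X0]. *)
Definition reaches (F : vector_field) (X0 : R * R) (t : R) (X : R * R) : Prop :=
  exists l r phi, is_solution_on F X0 l r phi /\ l < t < r /\ phi t = X.

(* The maximal interval I(X0) is the union of all the open intervals around 0
   carrying a solution; bounded ones suffice to exhaust it, even when I(X0) is
   unbounded. *)
Definition max_interval (F : vector_field) (X0 : R * R) (t : R) : Prop :=
  exists X, reaches F X0 t X.

(* For a locally Lipschitz [F] and [t] in I(X0), the point selected is unique;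
   for [t] outside I(X0) the value is meaningless. *)
Definition flow (F : vector_field) (t : R) (X0 : R * R) : R * R :=
  epsilon (inhabits (0, 0)) (reaches F X0 t).

Definition invariant (F : vector_field) (S : R * R -> Prop) : Prop :=
  forall X0, S X0 -> forall t, max_interval F X0 t -> S (flow F t X0).

Definition parabola (m : R) : R * R -> Prop :=
  fun X => snd X = m * fst X ^ 2.

(* Main.v *)
Require Import Defs.
From Stdlib Require Import Reals ClassicalEpsilon Lra Lia.
From Coquelicot Require Import Coquelicot.
Open Scope R_scope.

(** Along the field, [V = y - m x^2] has derivative [p(x)] on the parabola, with
    [p] a polynomial of degree at most 5 without constant term, and condition
    (1)-(2) says exactly that [p = 0].  If [p = 0] then [V' = g V] along every
    solution, for a continuous cofactor [g], so Gronwall keeps [V = 0].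
    Conversely, each point of the parabola lies on a solution (a power series,
    whose recursively defined coefficients grow at most geometrically because
    the field is quadratic), which is the flow by uniqueness (Gronwall again);
    by invariance [V] vanishes along it, hence so does its derivative at time 0. *)

(** * Local existence by power series *)

(** Structural recursion builds a table [pre n] that is correct up to index [n] and repeats its last
    entry afterwards; the sequence is the diagonal. By [step_ext], [step n] does not see the entries
    beyond [n]. *)
Lemma sequence_by_complete_recursion (T : Type) (x0 : T)
    (step : nat -> (nat -> T) -> T)
    (step_ext : forall n u v, (forall k, (k <= n)%nat -> u k = v k) ->
      step n u = step n v) :
  exists c : nat -> T, c 0%nat = x0 /\ forall n, c (S n) = step n c.
Proof.
  set (pre := fix pre (n : nat) : nat -> T := match n with
    | O => fun _ => x0
    | S p => fun k => if Nat.leb k p then pre p k else step p (pre p)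
    end).
  assert (Hpre : forall n k, (k <= n)%nat -> pre n k = pre k k).
  { induction n as [|n IH]; intros k Hk.
    - now replace k with 0%nat by lia.
    - destruct (Nat.eq_dec k (S n)) as [->|Hne]; [reflexivity|].
      simpl. rewrite (proj2 (Nat.leb_le k n)) by lia. apply IH; lia. }
  exists (fun n => pre n n); split; [reflexivity|].
  intros n.
  change (pre (S n) (S n))
    with (if Nat.leb (S n) n then pre n (S n) else step n (pre n)).
  rewrite (proj2 (Nat.leb_gt (S n) n)) by lia.
  apply step_ext. intros k Hk. now apply Hpre.
Qed.

(** Coefficient of [t ^ n] in one component of the quadratic field evaluated at the power series
    with coefficients [a] and [b]. *)
Definition quadratic_coef (c1 c2 c3 c4 c5 : R) (a b : nat -> R) (n : nat) : R :=
  c1 * a n + c2 * b n + c3 * PS_mult a a n + c4 * PS_mult b b n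
    + c5 * PS_mult a b n.

Lemma PS_mult_ext_le (a a' b b' : nat -> R) (n : nat) :
  (forall k, (k <= n)%nat -> a k = a' k) ->
  (forall k, (k <= n)%nat -> b k = b' k) ->
  PS_mult a b n = PS_mult a' b' n.
Proof.
  intros Ha Hb. unfold PS_mult. apply sum_eq. intros k Hk.
  rewrite Ha, Hb by lia. reflexivity.
Qed.

Lemma PSeries_quadratic_coef (c1 c2 c3 c4 c5 : R) (a b : nat -> R) (t : R) :
  Rbar_lt (Rabs t) (CV_radius a) -> Rbar_lt (Rabs t) (CV_radius b) ->
  PSeries (quadratic_coef c1 c2 c3 c4 c5 a b) t =
  c1 * PSeries a t + c2 * PSeries b t + c3 * PSeries a t ^ 2
    + c4 * PSeries b t ^ 2 + c5 * PSeries a t * PSeries b t.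
Proof.
  intros Ha Hb.
  assert (Ea := CV_radius_inside a t Ha).
  assert (Eb := CV_radius_inside b t Hb).
  assert (Eaa := ex_pseries_mult a a t Ha Ha).
  assert (Ebb := ex_pseries_mult b b t Hb Hb).
  assert (Eab := ex_pseries_mult a b t Ha Hb).
  assert (Es : forall (c : R) (u : nat -> R), ex_pseries u t -> ex_pseries (PS_scal c u) t).
  { intros c u Hu. apply ex_pseries_scal; [apply Rmult_comm | exact Hu]. }
  rewrite (PSeries_ext _ (PS_plus (PS_plus (PS_plus (PS_plus
    (PS_scal c1 a) (PS_scal c2 b)) (PS_scal c3 (PS_mult a a)))
    (PS_scal c4 (PS_mult b b))) (PS_scal c5 (PS_mult a b)))) by reflexivity.
  rewrite 4 PSeries_plus by auto 10 using ex_pseries_plus.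
  rewrite 5 PSeries_scal, 3 PSeries_mult by assumption.
  ring.
Qed.

Lemma PS_mult_geometric_bound (a b : nat -> R) (C K : R) (n : nat) :
  (forall k, (k <= n)%nat -> Rabs (a k) <= C * K ^ k) ->
  (forall k, (k <= n)%nat -> Rabs (b k) <= C * K ^ k) ->
  Rabs (PS_mult a b n) <= INR (S n) * (C ^ 2 * K ^ n).
Proof.
  intros Ha Hb. unfold PS_mult.
  eapply Rle_trans; [apply Rabs_triang_gen|].
  rewrite Rmult_comm, <- (sum_cte (C ^ 2 * K ^ n) n).
  apply sum_Rle. intros k Hk.
  rewrite Rabs_mult.
  replace (C ^ 2 * K ^ n) with ((C * K ^ k) * (C * K ^ (n - k))).
  - apply Rmult_le_compat; try apply Rabs_pos; [apply Ha | apply Hb]; lia.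
  - replace n with (k + (n - k))%nat at 2 by lia. rewrite pow_add. ring.
Qed.

(** Induction step for geometric growth of the Taylor coefficients. A Cauchy product has [n + 1]
    terms, each at most [C ^ 2 * K ^ n]; the division by [n + 1] coming from the recurrence cancels
    this factor, so one fixed ratio [K] works for all [n]. *)
Lemma quadratic_coef_bound (c1 c2 c3 c4 c5 A C K : R) (a b : nat -> R) (n : nat) :
  Rabs c1 + Rabs c2 + Rabs c3 + Rabs c4 + Rabs c5 <= A -> 0 <= C ->
  A * (1 + C) <= K ->
  (forall k, (k <= n)%nat -> Rabs (a k) <= C * K ^ k) ->
  (forall k, (k <= n)%nat -> Rabs (b k) <= C * K ^ k) ->
  Rabs (quadratic_coef c1 c2 c3 c4 c5 a b n / INR (S n)) <= C * K ^ S n.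
Proof.
  intros HA HC HK Ha Hb.
  assert (P1 := Rabs_pos c1). assert (P2 := Rabs_pos c2).
  assert (P3 := Rabs_pos c3). assert (P4 := Rabs_pos c4).
  assert (P5 := Rabs_pos c5).
  assert (HA0 : 0 <= A) by lra.
  assert (HK0 : 0 <= K) by nra.
  assert (HKn := pow_le K n HK0).
  assert (HN : 1 <= INR (S n)) by (rewrite S_INR; assert (H := pos_INR n); lra).
  set (N := INR (S n)) in *.
  (* A common bound for the linear terms, at most [C * K ^ n], and the quadratic ones, at most
     [N * C ^ 2 * K ^ n]. *)
  set (B := N * (C * (1 + C) * K ^ n)).
  assert (L0 : 0 <= C * K ^ n) by (apply Rmult_le_pos; lra).
  assert (Q0 : 0 <= C ^ 2 * K ^ n) by (apply Rmult_le_pos; [nra | lra]).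
  assert (BL : C * K ^ n <= B) by (unfold B; nra).
  assert (BQ : N * (C ^ 2 * K ^ n) <= B) by (unfold B; nra).
  assert (Hterm : forall c z, Rabs z <= B -> Rabs (c * z) <= Rabs c * B).
  { intros c z Hz. rewrite Rabs_mult.
    apply Rmult_le_compat_l; [apply Rabs_pos | exact Hz]. }
  assert (Hq : forall u v, (forall k, (k <= n)%nat -> Rabs (u k) <= C * K ^ k) ->
      (forall k, (k <= n)%nat -> Rabs (v k) <= C * K ^ k) ->
      Rabs (PS_mult u v n) <= B).
  { intros u v Hu Hv. eapply Rle_trans; [apply PS_mult_geometric_bound|]; eauto. }
  assert (H1 := Hterm c1 _ (Rle_trans _ _ _ (Ha n (le_n n)) BL)).
  assert (H2 := Hterm c2 _ (Rle_trans _ _ _ (Hb n (le_n n)) BL)).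
  assert (H3 := Hterm c3 _ (Hq a a Ha Ha)).
  assert (H4 := Hterm c4 _ (Hq b b Hb Hb)).
  assert (H5 := Hterm c5 _ (Hq a b Ha Hb)).
  assert (HB0 : 0 <= B) by lra.
  assert (HS : Rabs (quadratic_coef c1 c2 c3 c4 c5 a b n) <= A * B).
  { apply Rle_trans with
      ((Rabs c1 + Rabs c2 + Rabs c3 + Rabs c4 + Rabs c5) * B);
      [|now apply Rmult_le_compat_r].
    unfold quadratic_coef.
    do 4 (eapply Rle_trans; [apply Rabs_triang|];
          rewrite Rmult_plus_distr_r; apply Rplus_le_compat; [|assumption]).
    assumption. }
  unfold Rdiv. rewrite Rabs_mult, Rabs_inv, (Rabs_pos_eq N) by lra.
  apply Rmult_le_reg_r with N; [lra|].
  rewrite Rmult_assoc, Rinv_l, Rmult_1_r by lra.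
  apply Rle_trans with (1 := HS).
  replace (A * B) with (A * (1 + C) * (N * (C * K ^ n))) by (unfold B; ring).
  replace (C * K ^ S n * N) with (K * (N * (C * K ^ n))) by (simpl; ring).
  apply Rmult_le_compat_r; [nra | exact HK].
Qed.

Lemma CV_radius_geometric (a : nat -> R) (C K : R) :
  0 < K -> (forall n, Rabs (a n) <= C * K ^ n) -> Rbar_le (/ K) (CV_radius a).
Proof.
  intros HK Ha.
  apply (proj1 (CV_radius_bounded a)). exists C. intros n.
  assert (HKn := pow_lt K n HK).
  rewrite Rabs_mult, pow_inv, Rabs_inv, (Rabs_pos_eq (K ^ n)) by lra.
  apply Rmult_le_reg_r with (K ^ n); [exact HKn|].
  rewrite Rmult_assoc, Rinv_l, Rmult_1_r by lra. apply Ha.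
Qed.

Lemma quadratic_field_pair (a1 a2 a3 a4 a5 b1 b2 b3 b4 b5 : R) (X : R * R) :
  quadratic_field a1 a2 a3 a4 a5 b1 b2 b3 b4 b5 X =
  (a1 * fst X + a2 * snd X + a3 * fst X ^ 2 + a4 * snd X ^ 2 + a5 * fst X * snd X,
   b1 * fst X + b2 * snd X + b3 * fst X ^ 2 + b4 * snd X ^ 2 + b5 * fst X * snd X).
Proof. now destruct X. Qed.

Lemma quadratic_field_local_existence
    (a1 a2 a3 a4 a5 b1 b2 b3 b4 b5 : R) (X0 : R * R) :
  exists l r phi,
    is_solution_on (quadratic_field a1 a2 a3 a4 a5 b1 b2 b3 b4 b5) X0 l r phi.
Proof.
  set (cx c n := quadratic_coef a1 a2 a3 a4 a5
    (fun k => fst (c k : R * R)) (fun k => snd (c k)) n).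
  set (cy c n := quadratic_coef b1 b2 b3 b4 b5
    (fun k => fst (c k : R * R)) (fun k => snd (c k)) n).
  (* Comparing coefficients of [t ^ n] in X' = F(X) gives [n + 1] times the coefficient of index
     [n + 1] on the left, hence the division by [INR (S n)]. *)
  destruct (sequence_by_complete_recursion (R * R) X0
    (fun n c => (cx c n / INR (S n), cy c n / INR (S n)))) as [c [Hc0 HcS]].
  { intros n u v Huv.
    assert (Hu1 : forall k, (k <= n)%nat -> fst (u k) = fst (v k))
      by (intros k Hk; now rewrite Huv).
    assert (Hu2 : forall k, (k <= n)%nat -> snd (u k) = snd (v k))
      by (intros k Hk; now rewrite Huv).
    unfold cx, cy, quadratic_coef.
    rewrite (PS_mult_ext_le _ _ _ _ n Hu1 Hu1), (PS_mult_ext_le _ _ _ _ n Hu2 Hu2),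
      (PS_mult_ext_le _ _ _ _ n Hu1 Hu2), Hu1, Hu2 by lia.
    reflexivity. }
  set (a := fun k => fst (c k)). set (b := fun k => snd (c k)).
  set (A1 := Rabs a1 + Rabs a2 + Rabs a3 + Rabs a4 + Rabs a5).
  set (A2 := Rabs b1 + Rabs b2 + Rabs b3 + Rabs b4 + Rabs b5).
  assert (HA1 : 0 <= A1) by (unfold A1; repeat apply Rplus_le_le_0_compat; apply Rabs_pos).
  assert (HA2 : 0 <= A2) by (unfold A2; repeat apply Rplus_le_le_0_compat; apply Rabs_pos).
  (* [C] dominates both initial coordinates, which starts the induction; the [+ 1] in [K] keeps the
     radius [/ K] meaningful even for the zero field. *)
  set (C := Rabs (fst X0) + Rabs (snd X0)).
  assert (Hx0 := Rabs_pos (fst X0)). assert (Hy0 := Rabs_pos (snd X0)).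
  assert (HC : 0 <= C) by (unfold C; lra).
  set (K := (A1 + A2) * (1 + C) + 1).
  assert (HK : 0 < K) by (unfold K; nra).
  assert (Hbound : forall n k, (k <= n)%nat ->
      Rabs (a k) <= C * K ^ k /\ Rabs (b k) <= C * K ^ k).
  { induction n as [|n IH]; intros k Hk.
    - replace k with 0%nat by lia. unfold a, b. rewrite Hc0. simpl.
      unfold C. split; lra.
    - destruct (Nat.eq_dec k (S n)) as [->|Hne]; [|apply IH; lia].
      unfold a at 1, b at 1. rewrite HcS.
      split; apply (quadratic_coef_bound _ _ _ _ _ (A1 + A2));
        try (intros j Hj; now apply IH); try (unfold K; lra); try exact HC;
        fold A1 A2; lra. }
  assert (Hrad : forall t, - / K < t < / K ->
      Rbar_lt (Rabs t) (CV_radius a) /\ Rbar_lt (Rabs t) (CV_radius b)).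
  { intros t Ht.
    assert (Hlt : Rbar_lt (Rabs t) (/ K)) by (simpl; apply Rabs_def1; lra).
    split; apply (Rbar_lt_le_trans _ _ _ Hlt), (CV_radius_geometric _ C K HK);
      intros n; now apply (Hbound n). }
  assert (HKi := Rinv_0_lt_compat K HK).
  exists (- / K), (/ K), (fun t => (PSeries a t, PSeries b t)).
  split; [lra|]. split.
  { rewrite !PSeries_0. unfold a, b. rewrite Hc0. now destruct X0. }
  intros t Ht. destruct (Hrad t Ht) as [Ra Rb]. cbn [fst snd quadratic_field].
  rewrite <- !PSeries_quadratic_coef by assumption.
  split.
  - rewrite (PSeries_ext _ (PS_derive a)); [now apply is_derive_PSeries|].
    intros n. unfold PS_derive. unfold a at 2. rewrite HcS. cbn [fst].
    unfold cx. fold a b. field. apply not_0_INR. lia.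
  - rewrite (PSeries_ext _ (PS_derive b)); [now apply is_derive_PSeries|].
    intros n. unfold PS_derive. unfold b at 2. rewrite HcS. cbn [snd].
    unfold cy. fold a b. field. apply not_0_INR. lia.
Qed.

(** * Gronwall's lemma, uniqueness of solutions and the flow *)

(* The eta-expanded left-hand side is the form produced by [auto_derive]. *)
Lemma Derive_of_is_derive (f : R -> R) (t d : R) :
  is_derive f t d -> Derive (fun s => f s) t = d.
Proof. exact (is_derive_unique f t d). Qed.

(** With [G] the primitive of [g] vanishing at 0, the bound on [dW] makes [W * exp (- G)]
    nonincreasing and [W * exp G] nondecreasing. Both vanish at 0, so the first is at most 0 to the
    right of 0 and the second to the left. *)
Lemma gronwall_zero (W dW g : R -> R) (l r : R) :
  l < 0 < r -> W 0 = 0 ->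
  (forall t, l < t < r -> 0 <= W t) ->
  (forall t, l < t < r -> continuous g t) ->
  (forall t, l < t < r -> is_derive W t (dW t)) ->
  (forall t, l < t < r -> Rabs (dW t) <= g t * W t) ->
  forall t, l < t < r -> W t = 0.
Proof.
  intros H0 HW0 Hpos Hcont Hder Hbd.
  set (G := (fun t => RInt g 0 t) : R -> R).
  assert (HG : forall t, l < t < r -> is_derive G t (g t)).
  { intros t Ht. apply (is_derive_RInt g G 0 t); [|now apply Hcont].
    assert (Hd : 0 < Rmin (t - l) (r - t)) by (apply Rmin_pos; lra).
    exists (mkposreal _ Hd). intros s Hs.
    assert (Hs' := Rabs_def2 _ _ Hs).
    assert (M1 := Rmin_l (t - l) (r - t)). assert (M2 := Rmin_r (t - l) (r - t)).
    unfold minus, plus, opp in Hs'; simpl in Hs'.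
    apply (RInt_correct g 0 s), (ex_RInt_continuous g). intros z Hz. apply Hcont.
    unfold Rmin, Rmax in Hz. destruct (Rle_dec 0 s); lra. }
  assert (Hexp : forall e t, l < t < r ->
      is_derive (fun s => W s * exp (e * G s)) t
        ((dW t + e * g t * W t) * exp (e * G t))).
  { intros e t Ht. assert (D1 := Hder t Ht). assert (D2 := HG t Ht).
    auto_derive.
    - split; [now exists (dW t)|]. split; [now exists (g t) | trivial].
    - rewrite (Derive_of_is_derive _ _ _ D1), (Derive_of_is_derive _ _ _ D2). ring. }
  (* The mean value theorem between 0 and [t], for either sign of [t]; the sign [e] is chosen
     afterwards. *)
  assert (Hmvt : forall e t, l < t < r -> exists c, l < c < r /\
      W t * exp (e * G t) = ((dW c + e * g c * W c) * exp (e * G c)) * t).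
  { intros e t Ht.
    destruct (MVT_gen (fun s => W s * exp (e * G s)) 0 t
      (fun s => (dW s + e * g s * W s) * exp (e * G s))) as [c [Hc Heq]].
    - intros s Hs. apply Hexp. unfold Rmin, Rmax in Hs.
      destruct (Rle_dec 0 t); lra.
    - intros s Hs. apply continuity_pt_filterlim.
      apply (ex_derive_continuous (fun s => W s * exp (e * G s))).
      eexists. apply Hexp. unfold Rmin, Rmax in Hs.
      destruct (Rle_dec 0 t); lra.
    - exists c. split.
      + unfold Rmin, Rmax in Hc. destruct (Rle_dec 0 t); lra.
      + rewrite HW0 in Heq. lra. }
  intros t Ht. apply Rle_antisym; [|now apply Hpos].
  assert (Hfin : exists e, W t * exp (e * G t) <= 0).
  { destruct (Rle_dec 0 t) as [Hs|Hs].
    - exists (-1). destruct (Hmvt (-1) t Ht) as [c [Hc ->]].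
      assert (B := Hbd c Hc). apply Rabs_le_between in B.
      assert (P := exp_pos (-1 * G c)).
      assert (dW c + -1 * g c * W c <= 0) by lra.
      assert ((dW c + -1 * g c * W c) * exp (-1 * G c) <= 0) by nra. nra.
    - exists 1. destruct (Hmvt 1 t Ht) as [c [Hc ->]].
      assert (B := Hbd c Hc). apply Rabs_le_between in B.
      assert (P := exp_pos (1 * G c)).
      assert (0 <= dW c + 1 * g c * W c) by lra.
      assert (0 <= (dW c + 1 * g c * W c) * exp (1 * G c)) by nra. nra. }
  destruct Hfin as [e He]. assert (P := exp_pos (e * G t)). nra.
Qed.

Lemma quadratic_form_bound (p q s u v : R) :
  Rabs (p * u ^ 2 + q * u * v + s * v ^ 2) <=
  (Rabs p + Rabs q + Rabs s) * (u ^ 2 + v ^ 2).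
Proof.
  assert (Huv : Rabs (u * v) <= u ^ 2 + v ^ 2).
  { apply Rabs_le_between. split; nra. }
  replace (p * u ^ 2 + q * u * v + s * v ^ 2)
    with (p * u ^ 2 + q * (u * v) + s * v ^ 2) by ring.
  eapply Rle_trans; [apply Rabs_triang|].
  eapply Rle_trans; [apply Rplus_le_compat_r, Rabs_triang|].
  rewrite !Rabs_mult, (Rabs_pos_eq (u ^ 2)), (Rabs_pos_eq (v ^ 2)) by apply pow2_ge_0.
  rewrite <- Rabs_mult.
  assert (P1 := Rabs_pos p). assert (P2 := Rabs_pos q). assert (P3 := Rabs_pos s).
  assert (U := pow2_ge_0 u). assert (V := pow2_ge_0 v).
  assert (Rabs q * Rabs (u * v) <= Rabs q * (u ^ 2 + v ^ 2))
    by now apply Rmult_le_compat_l.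
  nra.
Qed.

(** Gronwall applied to the squared distance [W] of the two solutions on the common interval. Its
    derivative is a quadratic form in the coordinate differences, with coefficients [P], [Q], [S]
    continuous along the solutions, so it is bounded by a continuous multiple of [W]. *)
Lemma quadratic_field_uniqueness (a1 a2 a3 a4 a5 b1 b2 b3 b4 b5 : R) (X0 : R * R)
    (l r l' r' : R) (phi psi : R -> R * R) :
  is_solution_on (quadratic_field a1 a2 a3 a4 a5 b1 b2 b3 b4 b5) X0 l r phi ->
  is_solution_on (quadratic_field a1 a2 a3 a4 a5 b1 b2 b3 b4 b5) X0 l' r' psi ->
  forall t, l < t < r -> l' < t < r' -> phi t = psi t.
Proof.
  intros [H0 [Hphi0 Hphi]] [H0' [Hpsi0 Hpsi]] t Ht Ht'.
  set (x := fun s => fst (phi s)). set (y := fun s => snd (phi s)).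
  set (x' := fun s => fst (psi s)). set (y' := fun s => snd (psi s)).
  set (f := fun c1 c2 c3 c4 c5 u v : R =>
    c1 * u + c2 * v + c3 * u ^ 2 + c4 * v ^ 2 + c5 * u * v).
  assert (D : forall s, Rmax l l' < s < Rmin r r' ->
     is_derive x s (f a1 a2 a3 a4 a5 (x s) (y s)) /\
     is_derive y s (f b1 b2 b3 b4 b5 (x s) (y s)) /\
     is_derive x' s (f a1 a2 a3 a4 a5 (x' s) (y' s)) /\
     is_derive y' s (f b1 b2 b3 b4 b5 (x' s) (y' s))).
  { intros s [Hs1 Hs2].
    apply Rmax_Rlt in Hs1. apply Rmin_Rgt in Hs2.
    destruct (Hphi s) as [D1 D2]; [lra|]. destruct (Hpsi s) as [D3 D4]; [lra|].
    rewrite quadratic_field_pair in D1, D2, D3, D4.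
    exact (conj D1 (conj D2 (conj D3 D4))). }
  (* Difference quotients of the field:
     [f c (x, y) - f c (x', y') = p (x - x') + q (y - y')]. *)
  set (p := fun c1 c3 c5 s => c1 + c3 * (x s + x' s) + c5 * y s).
  set (q := fun c2 c4 c5 s => c2 + c4 * (y s + y' s) + c5 * x' s).
  set (W := fun s => (x s - x' s) ^ 2 + (y s - y' s) ^ 2).
  set (P := fun s => 2 * p a1 a3 a5 s).
  set (Q := fun s => 2 * (q a2 a4 a5 s + p b1 b3 b5 s)).
  set (S := fun s => 2 * q b2 b4 b5 s).
  assert (HW : W t = 0).
  { apply (gronwall_zero W (fun s => P s * (x s - x' s) ^ 2
        + Q s * (x s - x' s) * (y s - y' s) + S s * (y s - y' s) ^ 2)
      (fun s => Rabs (P s) + Rabs (Q s) + Rabs (S s)) (Rmax l l') (Rmin r r')).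
    - split; [apply Rmax_lub_lt | apply Rmin_glb_lt]; lra.
    - unfold W, x, y, x', y'. rewrite Hphi0, Hpsi0. ring.
    - intros s _. unfold W. assert (U := pow2_ge_0 (x s - x' s)).
      assert (V := pow2_ge_0 (y s - y' s)). lra.
    - intros s Hs. destruct (D s Hs) as (D1 & D2 & D3 & D4).
      assert (Hc : forall h, ex_derive h s -> continuous (fun s => Rabs (h s)) s).
      { intros h Hh. apply (continuous_comp h Rabs);
          [now apply (ex_derive_continuous h) | apply continuous_Rabs]. }
      apply (continuous_plus (fun s => Rabs (P s) + Rabs (Q s)));
        [apply (continuous_plus (fun s => Rabs (P s)))|]; apply Hc;
        unfold P, Q, S, p, q; auto_derive; repeat apply conj; try exact I; eexists; eassumption.
    - intros s Hs. destruct (D s Hs) as (D1 & D2 & D3 & D4).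
      unfold W. auto_derive; [repeat apply conj; try exact I; eexists; eassumption|].
      rewrite (Derive_of_is_derive _ _ _ D1), (Derive_of_is_derive _ _ _ D2),
        (Derive_of_is_derive _ _ _ D3), (Derive_of_is_derive _ _ _ D4).
      unfold P, Q, S, p, q, f. ring.
    - intros s _. apply quadratic_form_bound.
    - split; [apply Rmax_lub_lt | apply Rmin_glb_lt]; lra. }
  unfold W in HW.
  assert (U := pow2_ge_0 (x t - x' t)). assert (V := pow2_ge_0 (y t - y' t)).
  assert (Ex : x t - x' t = 0) by nra.
  assert (Ey : y t - y' t = 0) by nra.
  unfold x, x' in Ex. unfold y, y' in Ey.
  apply injective_projections; lra.
Qed.

(** [phi t] witnesses that some point is reached, so the point picked by [epsilon] lies on a
    solution from [X0]; uniqueness identifies the two. *)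
Lemma quadratic_flow_solution (a1 a2 a3 a4 a5 b1 b2 b3 b4 b5 : R) (X0 : R * R)
    (l r : R) (phi : R -> R * R) (t : R) :
  is_solution_on (quadratic_field a1 a2 a3 a4 a5 b1 b2 b3 b4 b5) X0 l r phi ->
  l < t < r ->
  flow (quadratic_field a1 a2 a3 a4 a5 b1 b2 b3 b4 b5) t X0 = phi t.
Proof.
  intros Hphi Ht.
  assert (Hr : reaches (quadratic_field a1 a2 a3 a4 a5 b1 b2 b3 b4 b5) X0 t
      (flow (quadratic_field a1 a2 a3 a4 a5 b1 b2 b3 b4 b5) t X0)).
  { apply (epsilon_spec (inhabits (0, 0)) (reaches _ X0 t)). now exists (phi t), l, r, phi. }
  destruct Hr as (l' & r' & psi & Hpsi & Ht' & <-).
  eapply quadratic_field_uniqueness; eauto.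
Qed.

(** * Tangency along the parabola and the coefficient conditions *)

(** The polynomial is y' - 2 m x x' at the point [(x, m * x ^ 2)], sorted by powers of [x]. *)
Lemma invariant_parabola_tangency (a1 a2 a3 a4 a5 b1 b2 b3 b4 b5 m x : R) :
  invariant (quadratic_field a1 a2 a3 a4 a5 b1 b2 b3 b4 b5) (parabola m) ->
  b1 * x + (m * (b2 - 2 * a1) + b3) * x ^ 2
    + m * (b5 - 2 * a3 - 2 * m * a2) * x ^ 3
    + m ^ 2 * (b4 - 2 * a5) * x ^ 4 - 2 * m ^ 3 * a4 * x ^ 5 = 0.
Proof.
  intros Hinv.
  destruct (quadratic_field_local_existence a1 a2 a3 a4 a5 b1 b2 b3 b4 b5
    (x, m * x ^ 2)) as (l & r & phi & Hsol).
  destruct (Hsol) as (H0 & Hphi0 & Hder).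
  assert (HV : forall t, l < t < r -> snd (phi t) - m * fst (phi t) ^ 2 = 0).
  { intros t Ht. rewrite <- (quadratic_flow_solution _ _ _ _ _ _ _ _ _ _ _ _ _ _ _ Hsol Ht).
    apply Rminus_diag_eq, (Hinv (x, m * x ^ 2) eq_refl).
    now exists (phi t), l, r, phi. }
  destruct (Hder 0 H0) as [D1 D2].
  rewrite quadratic_field_pair, Hphi0 in D1, D2. cbn [fst snd] in D1, D2.
  set (u := fun s => fst (phi s)). set (v := fun s => snd (phi s)).
  assert (Hu0 : u 0 = x) by (unfold u; now rewrite Hphi0).
  assert (DV : Derive (fun s => v s - m * u s ^ 2) 0 = 0).
  { rewrite (Derive_ext_loc _ (fun _ => 0)); [apply Derive_const|].
    apply (locally_interval _ 0 l r); simpl; try lra.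
    intros s Hs1 Hs2. now apply HV. }
  rewrite <- DV. symmetry. apply is_derive_unique.
  auto_derive; [repeat apply conj; try exact I; eexists; eassumption|].
  rewrite (Derive_of_is_derive u _ _ D1), (Derive_of_is_derive v _ _ D2), Hu0. ring.
Qed.

(** Five distinct nonzero sample points give an invertible linear system of Vandermonde type. *)
Lemma quintic_coefficients_zero (c1 c2 c3 c4 c5 : R) :
  (forall x, c1 * x + c2 * x ^ 2 + c3 * x ^ 3 + c4 * x ^ 4 + c5 * x ^ 5 = 0) ->
  c1 = 0 /\ c2 = 0 /\ c3 = 0 /\ c4 = 0 /\ c5 = 0.
Proof.
  intros H.
  assert (H1 := H 1). assert (H2 := H (-1)). assert (H3 := H 2).
  assert (H4 := H (-2)). assert (H5 := H 3). repeat split; lra.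
Qed.

(** The values substituted for [b1], [b4] and [a4] remove the terms of degree 1, 4 and 5 of the
    tangency polynomial; the two hypotheses remove those of degree 2 and 3. *)
Lemma parabola_invariant (a1 a2 a3 a5 b2 b3 b5 m : R) :
  m * (b2 - 2 * a1) + b3 = 0 -> b5 - 2 * a3 - 2 * m * a2 = 0 ->
  invariant (quadratic_field a1 a2 a3 0 a5 0 b2 b3 (2 * a5) b5) (parabola m).
Proof.
  intros E1 E2 X0 HX0 t Ht.
  destruct Ht as (X & l & r & phi & Hsol & Ht & HX).
  rewrite (quadratic_flow_solution _ _ _ _ _ _ _ _ _ _ _ _ _ _ _ Hsol Ht).
  destruct Hsol as (H0 & Hphi0 & Hder).
  set (x := fun s => fst (phi s)). set (y := fun s => snd (phi s)).
  assert (D : forall s, l < s < r ->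
     is_derive x s (a1 * x s + a2 * y s + a3 * x s ^ 2 + 0 * y s ^ 2 + a5 * x s * y s) /\
     is_derive y s (0 * x s + b2 * y s + b3 * x s ^ 2 + 2 * a5 * y s ^ 2 + b5 * x s * y s)).
  { intros s Hs. destruct (Hder s Hs) as [D1 D2].
    rewrite quadratic_field_pair in D1, D2. exact (conj D1 D2). }
  set (V := fun s => y s - m * x s ^ 2).
  (* Under [E1] and [E2] the derivative of [V] is [g V] identically,
     not only where [V = 0]. *)
  set (g := fun s => b2 + (b5 - 2 * m * a2) * x s + 2 * a5 * y s).
  (* [V] may change sign, so Gronwall is applied to its square, whose derivative is
     [2 * g * V ^ 2]. *)
  assert (HV : V t ^ 2 = 0).
  { apply (gronwall_zero (fun s => V s ^ 2) (fun s => 2 * g s * V s ^ 2)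
      (fun s => Rabs (2 * g s)) l r); try assumption.
    - unfold V, x, y. rewrite Hphi0. unfold parabola in HX0. rewrite HX0. ring.
    - intros s _. apply pow2_ge_0.
    - intros s Hs. destruct (D s Hs) as [D1 D2].
      apply (continuous_comp (fun s => 2 * g s) Rabs); [|apply continuous_Rabs].
      apply (ex_derive_continuous (fun s => 2 * g s)). unfold g.
      auto_derive; repeat apply conj; try exact I; eexists; eassumption.
    - intros s Hs. destruct (D s Hs) as [D1 D2]. unfold V.
      auto_derive; [repeat apply conj; try exact I; eexists; eassumption|].
      rewrite (Derive_of_is_derive _ _ _ D1), (Derive_of_is_derive _ _ _ D2).
      unfold g. replace b3 with (- (m * (b2 - 2 * a1))) by lra.
      replace b5 with (2 * a3 + 2 * m * a2) by lra. ring.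
    - intros s _. rewrite Rabs_mult, (Rabs_pos_eq (V s ^ 2)) by apply pow2_ge_0.
      apply Rle_refl. }
  unfold parabola. fold (x t) (y t). unfold V in HV.
  assert (y t - m * x t ^ 2 = 0) by nra. lra.
Qed.

Theorem theorem3p4 (a1 a2 a3 a4 a5 b1 b2 b3 b4 b5 m : R) (hm : m <> 0) :
  invariant (quadratic_field a1 a2 a3 a4 a5 b1 b2 b3 b4 b5) (parabola m) <->
  (b1 = 0 /\ b4 = 2 * a5 /\ a4 = 0) /\
  ((b3 = 0 /\ b2 = 2 * a1 /\ b5 <> 2 * a3 /\ a2 <> 0 /\
      m = (b5 - 2 * a3) / (2 * a2)) \/
   (b5 = 2 * a3 /\ a2 = 0 /\ b3 <> 0 /\ b2 <> 2 * a1 /\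
      m = - b3 / (b2 - 2 * a1)) \/
   (b3 <> 0 /\ b2 <> 2 * a1 /\ b5 <> 2 * a3 /\ a2 <> 0 /\
      2 * a2 * b3 + b2 * b5 - 2 * b2 * a3 - 2 * a1 * b5 + 4 * a1 * a3 = 0 /\
      m = - b3 / (b2 - 2 * a1) /\ m = (b5 - 2 * a3) / (2 * a2)) \/
   (b3 = 0 /\ b2 = 2 * a1 /\ b5 = 2 * a3 /\ a2 = 0)).
Proof.
  split.
  - intros Hinv.
    destruct (quintic_coefficients_zero b1 (m * (b2 - 2 * a1) + b3)
      (m * (b5 - 2 * a3 - 2 * m * a2)) (m ^ 2 * (b4 - 2 * a5)) (- 2 * m ^ 3 * a4))
      as (C1 & C2 & C3 & C4 & C5).
    { intros x. rewrite <- (invariant_parabola_tangency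
        a1 a2 a3 a4 a5 b1 b2 b3 b4 b5 m x Hinv). ring. }
    assert (Hm2 := pow_nonzero m 2 hm). assert (Hm3 := pow_nonzero m 3 hm).
    apply Rmult_integral in C3. destruct C3 as [|C3]; [contradiction|].
    apply Rmult_integral in C4. destruct C4 as [|C4]; [contradiction|].
    apply Rmult_integral in C5. destruct C5 as [C5|C5]; [exfalso; lra|].
    split; [repeat split; lra|].
    assert (Hm_y : b2 <> 2 * a1 -> m = - b3 / (b2 - 2 * a1)).
    { intros H. replace b3 with (- (m * (b2 - 2 * a1))) by lra. field. lra. }
    assert (Hm_x : a2 <> 0 -> m = (b5 - 2 * a3) / (2 * a2)).
    { intros H. replace (b5 - 2 * a3) with (2 * m * a2) by lra. now field. }
    (* Here and in [Hb5], [m <> 0] rules out the vanishing of the numerator in the formula for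
       [m]. *)
    assert (Hb3 : b2 <> 2 * a1 -> b3 <> 0).
    { intros H Hb. assert (P : m * (b2 - 2 * a1) = 0) by lra.
      apply Rmult_integral in P. lra. }
    assert (Hb5 : a2 <> 0 -> b5 <> 2 * a3).
    { intros H Hb. assert (P : m * a2 = 0) by lra.
      apply Rmult_integral in P. lra. }
    (* The two denominators decide the case: both zero is (d), only the first is (a), only the
       second is (b), neither is (c). *)
    destruct (Req_dec b2 (2 * a1)) as [Hb|Hb], (Req_dec a2 0) as [Ha|Ha].
    + right; right; right. subst. repeat split; lra.
    + left. repeat split; auto. rewrite Hb in C2. lra.
    + right; left. repeat split; auto. rewrite Ha in C3. lra.
    + right; right; left. repeat split; auto.
      (* The compatibility equation reads [2 * a2 * b3 + (b2 - 2 * a1) * (b5 - 2 * a3) = 0]: the two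
         formulas for [m] agree. *)
      replace b3 with (- (m * (b2 - 2 * a1))) by lra.
      replace b5 with (2 * a3 + 2 * m * a2) by lra. ring.
  - intros [(-> & -> & ->) Hcases].
    apply parabola_invariant.
    (* In (b) and (c) the first formula for [m] solves this equation; in (a) and (d) both of its
       terms vanish. *)
    + destruct Hcases as [H|[H|[H|H]]];
        [ | destruct H as (_ & _ & _ & H & ->) | destruct H as (_ & H & _ & _ & _ & -> & _) | ];
        try (field; lra); destruct H as (-> & -> & _); ring.
    + destruct Hcases as [H|[H|[H|H]]].
      * destruct H as (_ & _ & _ & H & ->). now field.
      * destruct H as (-> & -> & _). ring.
      * destruct H as (_ & _ & _ & H & _ & _ & ->). now field.
      * destruct H as (_ & _ & -> & ->). ring.
Qed.
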